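(* Let $\mathcal{L}$ be a Lie algebra over a field that is both Artinian and Noetherian, and let $\mathcal{L}=\mathcal{M}_1\oplus\cdots\oplus\mathcal{M}_r$ be an irreducible decomposition of $\mathcal{L}$. A bijective linear map $\phi:\mathcal{L}\to\mathcal{L}$ is a Lie algebra automorphism of $\mathcal{L}$ if and only if it has the form $\phi=\theta+\zeta$, where $\theta$ is a Lie algebra automorphism of $\mathcal{L}$ that maps each $\mathcal{M}_i$ to itself or to an isomorphic summand $\mathcal{M}_j$, and where $\zeta:\mathcal{L}\to\mathcal{L}$ is a linear map such that $\zeta(\mathcal{L})\subset\mathcal{Z}(\mathcal{L})$ and $\zeta(\mathcal{L}')=\{0\}$.
   Context: A Lie algebra is Artinian (resp. Noetherian) if it satisfies the descending (resp. ascending) chain condition on ideals. A decomposition $\mathcal{L}=\mathcal{M}_1\oplus\cdots\oplus\mathcal{M}_r$ means that the $\mathcal{M}_i$ are nonzero proper ideals of $\mathcal{L}$ and $\mathcal{L}$ is the vector space direct sum of the $\mathcal{M}_i$ (so $[\mathcal{M}_i,\mathcal{M}_j]=\{0\}$ for $i\ne j$). A Lie algebra is indecomposable if it cannot be expressed as a direct sum of proper ideals of itself; the decomposition is irreducible if each $\mathcal{M}_i$ is indecomposable. $\mathcal{Z}(\mathcal{L})$ denotes the centre of $\mathcal{L}$ and $\mathcal{L}'=[\mathcal{L},\mathcal{L}]$ its derived algebra. The symbol $\subset$ allows equality. *)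

(* Defs.v *)
From HB Require Import structures.
From mathcomp Require Import all_boot all_order all_algebra.
From mathcomp Require Import boolp classical_sets.

Set Implicit Arguments.
Unset Strict Implicit.
Unset Printing Implicit Defensive.

Import GRing.Theory.
Local Open Scope ring_scope.
Local Open Scope classical_set_scope.

HB.mixin Record isLieAlgebra (K : fieldType) L of GRing.Lmodule K L := {
  lie : L -> L -> L;
  lie_linearl : forall z : L, linear (fun x : L => lie x z);
  lie_linearr : forall z : L, linear (fun x : L => lie z x);
  liexx : forall x : L, lie x x = 0;
  lie_jacobi : forall x y z : L,
    lie x (lie y z) + lie y (lie z x) + lie z (lie x y) = 0
}.

#[short(type="lieAlgType")]
HB.structure Definition LieAlgebra (K : fieldType) :=
  {L of isLieAlgebra K L & GRing.Lmodule K L}.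

Section LieAlgebraNotions.
Variables (K : fieldType) (L : lieAlgType K).
Implicit Types (A B I : set L) (f : L -> L).

Definition subspace A : Prop :=
  A 0 /\ forall (a : K) (x y : L), A x -> A y -> A (a *: x + y).

(* [I] is an ideal of the subalgebra [A], itself seen as a Lie algebra; the
   ideals of [L] are those of [setT]. One side suffices by antisymmetry. *)
Definition lie_ideal A I : Prop :=
  [/\ I `<=` A, subspace I & forall x y : L, A x -> I y -> I (lie x y)].

Definition lie_artinian : Prop :=
  forall I : nat -> set L, (forall n, lie_ideal setT (I n)) ->
    (forall n, I n.+1 `<=` I n) ->
    exists N, forall n, (N <= n)%N -> I n = I N.

Definition lie_noetherian : Prop :=
  forall I : nat -> set L, (forall n, lie_ideal setT (I n)) ->
    (forall n, I n `<=` I n.+1) ->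
    exists N, forall n, (N <= n)%N -> I n = I N.

Definition direct_sum A (r : nat) (M : 'I_r -> set L) : Prop :=
  forall x : L, A x ->
    exists! u : {ffun 'I_r -> L}, (forall i, M i (u i)) /\ x = \sum_i u i.

(* [M i <> A] makes the summands proper, so that [1 < r]. The inclusion of the
   sum in [A] is part of [lie_ideal A (M i)], [A] being a subspace. *)
Definition lie_decomposition A (r : nat) (M : 'I_r -> set L) : Prop :=
  [/\ (0 < r)%N, forall i, lie_ideal A (M i), forall i, M i <> [set 0],
      forall i, M i <> A & direct_sum A M].

Definition lie_indecomposable A : Prop :=
  ~ exists (r : nat) (M : 'I_r -> set L), lie_decomposition A M.

Definition irreducible_decomposition A (r : nat) (M : 'I_r -> set L) : Prop :=
  lie_decomposition A M /\ forall i, lie_indecomposable (M i).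

Definition lie_center : set L := [set z | forall x : L, lie z x = 0].

Definition lie_derived : set L :=
  smallest subspace [set z | exists x y : L, z = lie x y].

(* The values of [f] outside [A] are irrelevant. *)
Definition lie_isomorphism A B f : Prop :=
  [/\ forall (a : K) (x y : L), A x -> A y -> f (a *: x + y) = a *: f x + f y,
      forall x y : L, A x -> A y -> f (lie x y) = lie (f x) (f y),
      forall x y : L, A x -> A y -> f x = f y -> x = y
    & f @` A = B].

Definition lie_isomorphic A B : Prop := exists f, lie_isomorphism A B f.

Definition lie_automorphism (f : {linear L -> L}) : Prop :=
  bijective f /\ forall x y : L, f (lie x y) = lie (f x) (f y).

End LieAlgebraNotions.

Arguments lie_artinian {K} L.
Arguments lie_noetherian {K} L.
Arguments lie_center {K} L.
Arguments lie_derived {K} L.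

(* Main.v *)
Require Import Defs.
From HB Require Import structures.
From mathcomp Require Import all_boot all_order all_algebra.
From mathcomp Require Import boolp classical_sets.

Set Implicit Arguments.
Unset Strict Implicit.
Unset Printing Implicit Defensive.

Import GRing.Theory.
Local Open Scope ring_scope.
Local Open Scope classical_set_scope.

(** The ideals of [L] are the submodules of its adjoint module, so the
    Krull-Schmidt argument applies in the centroid. Let [p_i] be the projections
    of the decomposition and [q_j = th p_j th^-1] those of its image under an
    automorphism [th]. By Fitting's lemma the nonunits of [p_k Centroid p_k] are
    nilpotent, so this ring is local; as [p_k] is the sum over [j] of the
    [p_k q_j p_k], one of these is invertible on [M_k]. Since elements of the
    centroid commute on brackets, [1 - q_j] then sends [M_k] into the centre, and
    [b = 1 - (1 - q_j) p_k] is an automorphism congruent to the identity modulo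
    the centre which maps [M_k] onto [th M_j] and fixes the other summands.
    Replacing [th] by [b^-1 th] for each [k] in turn, starting from [phi], yields
    the automorphism [theta] permuting the summands, and [phi - theta] is
    central. *)

(** * Functions that come with a proof of linearity *)

Section LinearFunctions.
Variables (K : fieldType) (V : lmodType K).
Implicit Types f g : V -> V.

(** Maps stay bare functions, since many arise as composites, iterates or inverses obtained by
    choice; bundling on demand transfers the library facts. *)
Lemma linear_bundle f : linear f -> exists g : {linear V -> V}, g =1 f.
Proof.
move=> lf; pose m := GRing.isLinear.Build K V V *:%R f lf.
by exists (HB.pack_for {linear V -> V} f m).
Qed.

Lemma linear_fun0 f : linear f -> f 0 = 0.
Proof. by move=> /linear_bundle[g fg]; rewrite -!fg linear0. Qed.

Lemma linear_funD f (lf : linear f) x y : f (x + y) = f x + f y.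
Proof. by have [g fg] := linear_bundle lf; rewrite -!fg linearD. Qed.

Lemma linear_funB f (lf : linear f) x y : f (x - y) = f x - f y.
Proof. by have [g fg] := linear_bundle lf; rewrite -!fg linearB. Qed.

Lemma linear_funN f (lf : linear f) x : f (- x) = - f x.
Proof. by have [g fg] := linear_bundle lf; rewrite -!fg linearN. Qed.

Lemma linear_fun_sum f (I : Type) (s : seq I) (F : I -> V) :
  linear f -> f (\sum_(i <- s) F i) = \sum_(i <- s) f (F i).
Proof.
move=> /linear_bundle[g fg]; rewrite -fg linear_sum.
by apply: eq_bigr => i _; rewrite fg.
Qed.

Lemma linear_fun_inj f :
  linear f -> (forall x, f x = 0 -> x = 0) -> injective f.
Proof.
move=> lf kf x y fxy; apply/eqP; rewrite -subr_eq0; apply/eqP/kf.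
by rewrite (linear_funB lf) fxy subrr.
Qed.

Lemma linear_inverse f g : linear f -> cancel f g -> cancel g f -> linear g.
Proof.
by move=> lf fg gf a x y; apply: (can_inj fg); rewrite lf !gf.
Qed.

End LinearFunctions.

(** * Brackets, the centroid and Fitting's lemma *)

Section LieAlgebras.
Variables (K : fieldType) (L : lieAlgType K).
Implicit Types (f g p q th : L -> L) (x y z : L).

Lemma lieDl x y z : lie (x + y) z = lie x z + lie y z.
Proof. exact: (linear_funD (lie_linearl z) x y). Qed.

Lemma lieBl x y z : lie (x - y) z = lie x z - lie y z.
Proof. exact: (linear_funB (lie_linearl z) x y). Qed.

Lemma lieDr z x y : lie z (x + y) = lie z x + lie z y.
Proof. exact: (linear_funD (lie_linearr z) x y). Qed.

Lemma lieBr z x y : lie z (x - y) = lie z x - lie z y.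
Proof. exact: (linear_funB (lie_linearr z) x y). Qed.

Lemma lie0r z : lie z 0 = 0.
Proof. exact: (linear_fun0 (lie_linearr z)). Qed.

Lemma lieC x y : lie x y = - lie y x.
Proof.
have := liexx (x + y); rewrite lieDl !lieDr !liexx add0r addr0.
by move/eqP; rewrite addr_eq0 => /eqP.
Qed.

Lemma lie_centerr z x : lie_center L z -> lie x z = 0.
Proof. by move=> zc; rewrite lieC zc oppr0. Qed.

Lemma lie_center0 : lie_center L 0.
Proof. by move=> x; rewrite lieC lie0r oppr0. Qed.

Lemma lie_centerB x y :
  lie_center L x -> lie_center L y -> lie_center L (x - y).
Proof. by move=> xc yc z; rewrite lieBl xc yc subrr. Qed.

Lemma lie_centerD x y :
  lie_center L x -> lie_center L y -> lie_center L (x + y).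
Proof. by move=> xc yc z; rewrite lieDl xc yc addr0. Qed.

(** The bracket descends to the quotient by the centre, so central corrections do not affect it. *)
Lemma lie_mod_center x x' y y' :
  lie_center L (x - x') -> lie_center L (y - y') -> lie x y = lie x' y'.
Proof.
move=> xc yc; rewrite -[x in LHS](subrK x') lieDl xc add0r.
by rewrite -[y in LHS](subrK y') lieDr (lie_centerr _ yc) add0r.
Qed.

(* The endomorphisms of the adjoint module, whose submodules are the ideals. *)
Definition centroid f : Prop :=
  linear f /\ forall x y, f (lie x y) = lie x (f y).

Lemma centroidl f x y : centroid f -> f (lie x y) = lie (f x) y.
Proof. by case=> lf fl; rewrite lieC (linear_funN lf) fl -lieC. Qed.

Lemma centroid_comp f g : centroid f -> centroid g -> centroid (f \o g).
Proof.
by move=> [lf fl] [lg gl]; split=> [a x y|x y] /=; rewrite ?lg ?lf // gl fl.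
Qed.

Lemma centroidD f g : centroid f -> centroid g -> centroid (fun x => f x + g x).
Proof.
move=> [lf fl] [lg gl]; split=> [a x y|x y] /=; last by rewrite fl gl lieDr.
by rewrite lf lg scalerDr addrACA.
Qed.

Lemma centroidB f g : centroid f -> centroid g -> centroid (fun x => f x - g x).
Proof.
move=> [lf fl] [lg gl]; split=> [a x y|x y] /=; last by rewrite fl gl lieBr.
by rewrite lf lg scalerBr opprD addrACA.
Qed.

Lemma centroid_sum (I : Type) (s : seq I) (F : I -> L -> L) :
  (forall i, centroid (F i)) -> centroid (fun x => \sum_(i <- s) F i x).
Proof.
move=> cF; elim: s => [|i s IH].
  split=> [a x y|x y]; rewrite !big_nil ?lie0r //.
  by rewrite scaler0 addr0.
suff -> : (fun x => \sum_(j <- i :: s) F j x) =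
          (fun x => F i x + \sum_(j <- s) F j x) by exact: centroidD.
by apply/funext => x; rewrite big_cons.
Qed.

Lemma centroid_iter n f : centroid f -> centroid (iter n f).
Proof. by move=> cf; elim: n => // n IH; apply: (centroid_comp cf IH). Qed.

Lemma centroid_inverse f g :
  centroid f -> cancel f g -> cancel g f -> centroid g.
Proof.
move=> [lf fl] fg gf; split; first exact: linear_inverse fg gf.
by move=> x y; apply: (can_inj fg); rewrite fl !gf.
Qed.

Lemma centroid_conj th th' f :
  linear th -> (forall x y, th (lie x y) = lie (th x) (th y)) ->
  cancel th th' -> cancel th' th -> centroid f -> centroid (th \o f \o th').
Proof.
move=> lth hth thK th'K [lf fl]; have lth' := linear_inverse lth thK th'K.
split=> [a x y|x y] /=; first by rewrite lth' lf lth.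
have -> : th' (lie x y) = lie (th' x) (th' y).
  by apply: (can_inj thK); rewrite hth !th'K.
by rewrite fl hth th'K.
Qed.

(** Moving [f] and [g] to opposite arguments gives [lie (f x) (g y)] in either order. *)
Lemma centroid_comm f g x y :
  centroid f -> centroid g -> f (g (lie x y)) = g (f (lie x y)).
Proof.
by move=> cf cg; rewrite (centroidl _ _ cf) !cg.2 (centroidl _ _ cf).
Qed.

Lemma centroid_ker_ideal f : centroid f -> lie_ideal setT [set x | f x = 0].
Proof.
move=> [lf fl]; split=> //=; last by move=> x y _ /= fy; rewrite fl fy lie0r.
split=> [|a x y /= fx fy]; first exact: linear_fun0.
by rewrite lf fx fy scaler0 addr0.
Qed.

Lemma centroid_range_ideal f : centroid f -> lie_ideal setT (range f).
Proof.
move=> [lf fl]; split=> //=.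
  split=> [|a _ _ [x _ <-] [y _ <-]]; first by exists 0; rewrite ?linear_fun0.
  by exists (a *: x + y); rewrite ?lf.
by move=> x _ _ [y _ <-]; exists (lie x y); rewrite ?fl.
Qed.

(** Ranges of the iterates form a descending chain of ideals, kernels an ascending one. Once both
    are stable, [iter n f] and its square have equal range and kernel, so the range and the kernel
    of [iter n f] are complementary. *)
Lemma Fitting f : lie_artinian L -> lie_noetherian L -> centroid f ->
  exists n, [/\ (0 < n)%N, forall x, exists w, iter n f x = iter (n + n) f w
    & forall x, iter (n + n) f x = 0 -> iter n f x = 0].
Proof.
move=> art noeth cf.
have [||N1 H1] := art (fun n => range (iter n f)).
- by move=> n; apply/centroid_range_ideal/centroid_iter.
- by move=> n _ [x _ <-]; exists (f x); rewrite // -iterSr.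
have [||N2 H2] := noeth (fun n => [set x | iter n f x = 0]).
- by move=> n; apply/centroid_ker_ideal/centroid_iter.
- by move=> n x /= h; rewrite h linear_fun0 //; case: cf.
(* The successor keeps [n] positive, so that a factor [f] can later be split off [iter n f]. *)
pose n := (N1 + N2).+1; exists n; split=> // x.
  have : range (iter n f) (iter n f x) by exists x.
  rewrite H1; last by rewrite /n leqW // leq_addr.
  rewrite -(H1 (n + n)%N); last by rewrite /n addSn leqW // -addnA leq_addr.
  by case=> w _ <-; exists w.
move=> h; suff : [set x | iter n f x = 0] x by [].
rewrite H2; last by rewrite /n leqW // leq_addl.
rewrite -(H2 (n + n)%N) //; rewrite /n addSn leqW //.
by rewrite -addnA addnCA leq_addr.
Qed.

(** If both ideals were nonzero, both would be proper, since one equal to [A] would contain the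
    other; they would then decompose [A]. *)
Lemma indecomposable_binary (A I J : set L) :
  lie_indecomposable A -> lie_ideal A I -> lie_ideal A J ->
  (forall x, A x -> exists a b, [/\ I a, J b & x = a + b]) ->
  (forall x, I x -> J x -> x = 0) -> I = [set 0] \/ J = [set 0].
Proof.
move=> indA iI iJ dec triv.
case: (pselect (I = [set 0])) => [->|I0]; first by left.
case: (pselect (J = [set 0])) => [->|J0]; first by right.
have [sIA [I00 Ilin] Ilie] := iI; have [sJA [J00 Jlin] Jlie] := iJ.
case: indA; exists 2, (fun i : 'I_2 => if i == ord0 then I else J).
split=> // [i|i|i|x Ax].
- by case: ifP.
- by case: ifP.
- case: ifP => _ E; [apply: J0|apply: I0]; apply/seteqP; split=> x.
  + by move=> Jx; apply: triv => //; rewrite E; apply: sJA.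
  + by move=> /= ->.
  + by move=> Ix; apply: triv => //; rewrite E; apply: sIA.
  + by move=> /= ->.
have [a [b [Ia Jb ->]]] := dec x Ax.
exists [ffun i : 'I_2 => if i == ord0 then a else b]; split.
  split=> [i|]; first by rewrite ffunE; case: ifP.
  by rewrite big_ord_recl big_ord1 !ffunE.
move=> u [uM]; rewrite big_ord_recl big_ord1 => E.
have Iu : I (u ord0) := uM ord0.
have Ju : J (u (lift ord0 ord0)) := uM (lift ord0 ord0).
(* This difference of first components is also one of second components, so it lies in both [I] and
   [J]. *)
have d0 : a - u ord0 = 0.
  apply: triv; first by rewrite addrC -scaleN1r; apply: Ilin.
  have -> : a - u ord0 = -1 *: b + u (lift ord0 ord0).
    rewrite scaleN1r; apply/eqP.
    by rewrite subr_eq -addrA [u _ + _]addrC -E addrC addrK.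
  exact: Jlin.
have ea : a = u ord0 by apply/eqP; rewrite -subr_eq0 d0.
have eb : b = u (lift ord0 ord0) by move: E; rewrite ea => /addrI.
apply/ffunP => i; rewrite ffunE; case: ifP => [/eqP->|] //.
case: i => [[|[|m]] hm] // _; rewrite eb; congr (u _); exact: val_inj.
Qed.

(** * The corner ring of an indecomposable ideal is local *)

Section Corner.
Variables (p : L -> L) (cp : centroid p) (pp : forall x, p (p x) = p x).
Hypothesis indp : lie_indecomposable [set x | p x = x].
Hypotheses (artL : lie_artinian L) (noethL : lie_noetherian L).

(** The ring [p Centroid p], with identity [p], encoded as maps on all of [L]. *)
Definition corner f : Prop :=
  [/\ centroid f, forall x, p (f x) = f x & forall x, f (p x) = f x].

Definition corner_unit f : Prop :=
  (forall x, p x = x -> f x = 0 -> x = 0) /\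
  (forall y, p y = y -> exists2 x, p x = x & f x = y).

Lemma cornerD f g : corner f -> corner g -> corner (fun x => f x + g x).
Proof.
move=> [cf pf fp] [cg pg gp]; split=> [|x|x]; first exact: centroidD.
  by rewrite (linear_funD cp.1) pf pg.
by rewrite fp gp.
Qed.

(** Fitting splits the range of [p] into the range [I] of [iter n f] and the kernel [J] of
    [iter n f] inside it. By indecomposability one is zero: [I] gives nilpotency, [J] gives
    bijectivity on the range of [p]. *)
Lemma corner_nilpotent_or_unit f : corner f ->
  (exists n, forall x, iter n f x = 0) \/ corner_unit f.
Proof.
move=> [cf pf fp]; have [n [n0 im ker]] := Fitting artL noethL cf.
have [lp pl] := cp; have cfn := centroid_iter n cf; have [lfn fnl] := cfn.
have pfn x : p (iter n f x) = iter n f x.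
  by rewrite -(prednK n0) /= pf.
pose I := range (iter n f); pose J := [set x | p x = x /\ iter n f x = 0].
have [||||I0|J0] := @indecomposable_binary [set x | p x = x] I J indp.
- have [_ sI lI] := centroid_range_ideal cfn; split=> //.
    by move=> _ [x _ <-] /=.
  by move=> x y _; apply: lI.
- split=> [x []//||x y _ [py fy]].
    split=> [|a x y [px fx] [py fy]]; first by rewrite /J /= !linear_fun0.
    by rewrite /J /= lp lfn px py fx fy scaler0 addr0.
  by rewrite /J /= pl fnl py fy lie0r.
- move=> x /= px; have [w fw] := im x.
  exists (iter n f w), (x - iter n f w); split; last by rewrite addrC subrK.
    by exists w.
  by rewrite /J /= (linear_funB lp) (linear_funB lfn) px pfn fw iterD subrr.
- by move=> _ [w _ <-] [_]; rewrite -iterD => /ker.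
- left; exists n => x; suff : I (iter n f x) by rewrite I0.
  by exists x.
right; split=> [x px fx|y py].
  suff : J x by rewrite J0.
  split=> //; rewrite -(prednK n0) iterSr fx.
  by apply: linear_fun0; case: (centroid_iter n.-1 cf).
have [w fw] := im y.
have : J (y - iter n f w).
  by rewrite /J /= (linear_funB lp) (linear_funB lfn) py pfn fw iterD subrr.
rewrite J0 /= => /eqP; rewrite subr_eq0 => /eqP ->.
by exists (p (iter n.-1 f w)); rewrite // fp -(prednK n0).
Qed.

(* The unit [f] of the corner ring extends to the invertible map
   [f + (1 - p)] of [L], whose inverse [v] satisfies [v f = p]. *)
Lemma corner_unit_inverse f : corner f -> corner_unit f ->
  exists v, [/\ centroid v, forall x, p (v x) = v (p x)
    & forall x, v (f x) = p x].
Proof.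
move=> [cf pf fp] [injf surjf]; have [lp _] := cp; have [lf _] := cf.
pose u x := f x + (x - p x).
have cu : centroid u by apply/centroidD/centroidB.
have pu x : p (u x) = f x.
  by rewrite /u (linear_funD lp) (linear_funB lp) pp subrr addr0 pf.
have uinj : injective u.
  apply: linear_fun_inj => [|x ux]; first by case: cu.
  have fx : f x = 0 by rewrite -pu ux linear_fun0.
  have px : p x = 0 by apply: injf; rewrite // fp.
  by move: ux; rewrite /u fx px subr0 add0r.
have /choice[v uv] : forall y, exists x, u x = y.
  move=> y; have [z pz fz] := surjf (p y) (pp y).
  exists (z + (y - p y)); rewrite /u (linear_funD lp) (linear_funD lf).
  rewrite (linear_funB lp) (linear_funB lf) pp fp pz fz !subrr !addr0.
  by rewrite addrAC subrr add0r addrC subrK.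
have vu : cancel u v by move=> x; apply: uinj; rewrite uv.
exists v; split=> [|x|x]; first exact: centroid_inverse vu uv.
  apply: uinj; rewrite uv; have := pu (v x); rewrite uv => ->.
  by rewrite /u fp pp subrr addr0.
by apply: uinj; rewrite uv /u fp pp subrr addr0.
Qed.

Hypothesis pn0 : [set x | p x = x] <> [set 0].

(** A nilpotent map cannot be injective on the nonzero range of [p]. *)
Lemma corner_unit_of_injective f : corner f ->
  (forall x, p x = x -> f x = 0 -> x = 0) -> corner_unit f.
Proof.
move=> cf injf; case: (corner_nilpotent_or_unit cf) => // -[n fn].
have [_ pf _] := cf; case: pn0; apply/seteqP; split=> x /= px; last first.
  by rewrite px linear_fun0 //; case: cp.
move: (fn x) => {fn}; elim: n x px => // n IH x px; rewrite iterSr => fnx.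
exact: injf (IH _ (pf x) fnx).
Qed.

(** Let [v] invert [f + g] and put [h = v f]. If [h] is a unit, [f] is injective on the range of
    [p]. If [h] is nilpotent, a zero [x] of [g] in that range satisfies [h x = x], hence
    vanishes. *)
Lemma corner_unitD f g : corner f -> corner g ->
  corner_unit (fun x => f x + g x) -> corner_unit f \/ corner_unit g.
Proof.
move=> cf cg uu; have [v [cv pv vu]] := corner_unit_inverse (cornerD cf cg) uu.
have [lv _] := cv.
have ch : corner (v \o f).
  case: cf => cf pf fp; split=> [|x|x] /=; first exact: centroid_comp.
    by rewrite pv pf.
  by rewrite fp.
case: (corner_nilpotent_or_unit ch) => [[n hn]|[injh _]].
  right; apply: corner_unit_of_injective => // x px gx.
  have hx : v (f x) = x by rewrite -[RHS]px -vu gx addr0.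
  by rewrite -(hn x); elim: n {hn} => //= n <-.
left; apply: corner_unit_of_injective => // x px fx; apply: injh => //=.
by rewrite fx linear_fun0.
Qed.

Lemma corner_unit_sum (I : Type) (s : seq I) (F : I -> L -> L) :
  (forall i, corner (F i)) -> corner_unit (fun x => \sum_(i <- s) F i x) ->
  exists i, corner_unit (F i).
Proof.
move=> cF; elim: s => [|i s IH].
  case=> inj0 _; case: pn0; apply/seteqP; split=> x /= px.
    by apply: inj0 => //; rewrite big_nil.
  by rewrite px linear_fun0 //; case: cp.
have -> : (fun x => \sum_(j <- i :: s) F j x) =
          (fun x => F i x + \sum_(j <- s) F j x).
  by apply/funext => x; rewrite big_cons.
move=> /corner_unitD[||ui|/IH//]; [exact: cF| |by exists i].
split=> [|x|x].
- by apply: centroid_sum => j; case: (cF j).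
- rewrite linear_fun_sum; last by case: cp.
  by apply: eq_bigr => j _; case: (cF j).
- by apply: eq_bigr => j _; case: (cF j).
Qed.

End Corner.

(** * The exchange automorphism *)

Section Exchange.
Variables (p q : L -> L) (cp : centroid p) (cq : centroid q).
Hypotheses (pp : forall x, p (p x) = p x) (qq : forall x, q (q x) = q x).
Hypothesis upq : corner_unit p (p \o q \o p).

(** Equal to [q] on the range of [p] and to the identity on the kernel of [p]. *)
Definition exchange x := x - (p x - q (p x)).

Lemma exchange_centroid : centroid exchange.
Proof. by apply/centroidB/centroidB/centroid_comp. Qed.

(** The bracket of [q' (p x)] with [y] depends only on [p y], which surjectivity of [p q p] writes
    as [p (q z)]. Moving [q'] to the other argument then produces [q' (q z) = 0]. *)
Lemma exchange_central x : lie_center L (exchange x - x).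
Proof.
have [[lp pl] [lq ql]] := (cp, cq).
pose q' z := z - q z; have cq' : centroid q' by apply: centroidB.
have -> : exchange x - x = 0 - q' (p x) by rewrite /exchange addrAC subrr.
apply: (lie_centerB lie_center0) => y.
have -> : lie (q' (p x)) y = lie (q' (p x)) (p y).
  rewrite -pl -!(centroidl _ _ cq') -(centroid_comm _ _ cq' cp).
  by rewrite (centroidl _ _ cp) pp.
have [z pz <-] := upq.2 (p y) (pp y).
rewrite /= pz -pl -(centroidl _ _ cq') cq'.2 /q' qq subrr lie0r.
exact: linear_fun0.
Qed.

Lemma exchange_bij : bijective exchange.
Proof.
have [lp [lq le]] := (cp.1, (cq.1, exchange_centroid.1)).
have [injpq surjpq] := upq.
have ker z : p z = 0 -> exchange z = z.
  by rewrite /exchange => ->; rewrite linear_fun0 // subrr subr0.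
have inje : injective exchange.
  apply: linear_fun_inj => // x ex; rewrite -(ker x) //.
  apply: injpq; first exact: pp.
  rewrite /= pp; have := congr1 p ex; rewrite linear_fun0 // /exchange.
  by rewrite !(linear_funB lp) pp subKr.
have /choice[g eg] : forall y, exists x, exchange x = y.
  move=> y; have [z pz /= fz] := surjpq (p y) (pp y).
  (* Here [exchange z = q z], while [y - q z] lies in the kernel of [p] and is fixed. *)
  exists (z + (y - q z)); rewrite (linear_funD le) (ker (y - _)).
    by rewrite /exchange pz subKr addrC subrK.
  by rewrite (linear_funB lp) -[in q z]pz fz subrr.
by exists g => // x; apply: inje; rewrite eg.
Qed.

End Exchange.

(** * Projections of a decomposition, and automorphisms as functions *)

Lemma decomposition_projections r (M : 'I_r -> set L) :
  lie_decomposition setT M -> exists p : 'I_r -> L -> L,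
  [/\ forall i, centroid (p i), forall i x, M i x <-> p i x = x,
      forall i x, p i (p i x) = p i x, forall i j x, i != j -> p i (p j x) = 0
    & forall x, \sum_i p i x = x].
Proof.
case=> _ iM _ _ ds.
have /choice[u uP] : forall x, exists u : {ffun 'I_r -> L},
    [/\ forall i, M i (u i), x = \sum_i u i &
     forall v : 'I_r -> L, (forall i, M i (v i)) -> x = \sum_i v i -> u =1 v].
  move=> x; have [u [[uM xu] uniq]] := ds x Logic.I.
  exists u; split=> // v vM xv i.
  rewrite (uniq [ffun i => v i]) ?ffunE //; split=> [j|]; rewrite ?ffunE //.
  by rewrite xv; apply: eq_bigr => j _; rewrite ffunE.
have uM x i : M i (u x i) by case: (uP x).
have usum x : \sum_i u x i = x by case: (uP x).
have uE x (v : 'I_r -> L) : (forall i, M i (v i)) -> x = \sum_i v i -> u x =1 v.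
  by case: (uP x) => _ _; apply.
have M0 i : M i 0 by case: (iM i) => _ [].
have uMi i x j : M i x -> u x j = if j == i then x else 0.
  move=> Mx; apply: (uE x (fun j => if j == i then x else 0)) => [k|].
    by case: ifP => [/eqP->|].
  by rewrite -big_mkcond big_pred1_eq.
(* Uniqueness of components makes them linear and, each [M i] being an ideal, compatible with
   brackets. *)
exists (fun i x => u x i); split=> // [i|i x|i x|i j x ij].
- split=> [a x y|x y].
    apply: (uE _ (fun i => a *: u x i + u y i)) => [j|].
      by case: (iM j) => _ [_ Mlin] _; apply: Mlin.
    by rewrite big_split -scaler_sumr !usum.
  apply: (uE _ (fun i => lie x (u y i))) => [j|].
    by case: (iM j) => _ _ Mlie; apply: Mlie.
  by rewrite -(linear_fun_sum _ _ (lie_linearr x)) usum.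
- by split=> [/uMi->|<-//]; rewrite eqxx.
- by rewrite (uMi i) // eqxx.
- by rewrite (uMi j) // (negPf ij).
Qed.

Definition lie_automorphism_fun th : Prop :=
  [/\ linear th, bijective th & forall x y, th (lie x y) = lie (th x) (th y)].

(** In [f (lie x y) = lie x (f y)], [x] may be replaced by [f x], which differs from it by a central
    element. *)
Lemma central_centroid_automorphism f :
  centroid f -> bijective f -> (forall x, lie_center L (f x - x)) ->
  lie_automorphism_fun f.
Proof.
move=> cf bf fz; split=> //; first by case: cf.
move=> x y; rewrite cf.2; symmetry; apply: lie_mod_center => //.
by rewrite subrr; apply: lie_center0.
Qed.

Lemma automorphism_fun_inverse f g : lie_automorphism_fun f ->
  cancel f g -> cancel g f -> lie_automorphism_fun g.
Proof.
move=> [lf _ hf] fg gf; split; first exact: linear_inverse fg gf.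
  by exists f.
by move=> x y; apply: (can_inj fg); rewrite hf !gf.
Qed.

Lemma automorphism_fun_comp f g : lie_automorphism_fun f ->
  lie_automorphism_fun g -> lie_automorphism_fun (f \o g).
Proof.
move=> [lf bf hf] [lg bg hg]; split; last by move=> x y /=; rewrite hg hf.
  by move=> a x y /=; rewrite lg lf.
exact: bij_comp.
Qed.

(** * Exchanging the summands one by one *)

Section ExchangeStep.
Hypotheses (artL : lie_artinian L) (noethL : lie_noetherian L).
Variables (r : nat) (M : 'I_r -> set L).
Hypothesis decM : irreducible_decomposition setT M.

(** One replacement of [th] by [b^-1 th]. The last clause keeps the summands obtained earlier, so
    the step can be iterated. *)
Lemma exchange_automorphism th k : lie_automorphism_fun th ->
  exists th' j, [/\ lie_automorphism_fun th',
    forall x, lie_center L (th x - th' x), th' @` M j = M k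
    & forall i i', i != k -> th @` M i' = M i -> th' @` M i' = M i].
Proof.
move=> ath; have [lth [thi thK thiK] hth] := ath.
have athi := automorphism_fun_inverse ath thK thiK; have [lthi _ hthi] := athi.
have [decM1 indM] := decM.
have [p [cp pM pp pp0 psum]] := decomposition_projections decM1.
have ME i : M i = [set x | p i x = x].
  by apply/seteqP; split=> x /= /pM.
pose q j := th \o p j \o thi.
have cq j : centroid (q j) by exact: centroid_conj.
have qq j x : q j (q j x) = q j x by rewrite /q /= thK pp.
have pkn0 : [set x | p k x = x] <> [set 0] by rewrite -ME; case: decM1.
have indk : lie_indecomposable [set x | p k x = x] by rewrite -ME.
(* The sum over [j] of these corner elements is [p k], the identity of a local ring. *)
have [j upq] : exists j, corner_unit (p k) (p k \o q j \o p k).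
  apply: (@corner_unit_sum _ (cp k) (pp k) indk artL noethL pkn0 _
           (index_enum 'I_r)).
    move=> j; split=> [|x|x] /=; rewrite ?pp //.
    by do 2?[apply: centroid_comp => //].
  have -> : (fun x => \sum_i (p k \o q i \o p k) x) = p k.
    apply/funext => x; rewrite -(linear_fun_sum _ _ (cp k).1).
    by rewrite -(linear_fun_sum _ _ lth) psum thiK pp.
  by split=> [x -> //|y py]; exists y.
have [injpq surjpq] := upq.
(* [M j] is the direct sum of the image of [M k] under [p_j th^-1] and of the
   kernel of [p_k th] in [M j]. *)
have MjE y : M j y -> exists2 x, M k x & y = p j (thi x).
  have lj := (cp j).1; have lk := (cp k).1.
  pose I := [set y | exists2 x, M k x & y = p j (thi x)].
  pose J := [set y | M j y /\ p k (th y) = 0].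
  have [_ iM Mn0 _ _] := decM1.
  have Ij : lie_ideal (M j) I.
    split=> [_ [x _ ->]||y' _ My' [x Mx ->]]; first by apply/pM.
      split=> [|a _ _ [x Mx ->] [x' Mx' ->]].
        exists 0; last by rewrite (linear_fun0 lthi) (linear_fun0 lj).
        by apply/pM; rewrite (linear_fun0 lk).
      exists (a *: x + x'); last by rewrite lthi lj.
      by apply/pM; rewrite lk; congr (_ *: _ + _); apply/pM.
    exists (lie (th y') x); last by rewrite hthi thK (cp j).2.
    by apply/pM; rewrite (cp k).2; congr lie; apply/pM.
  have Jj : lie_ideal (M j) J.
    split=> [x []//||x x' Mx [Mx' x'0]].
      split=> [|a x x' [Mx x0] [Mx' x'0]]; split.
      - by apply/pM; rewrite (linear_fun0 lj).
      - by rewrite (linear_fun0 lth) (linear_fun0 lk).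
      - by apply/pM; rewrite lj; congr (_ *: _ + _); apply/pM.
      - by rewrite lth lk x0 x'0 scaler0 addr0.
    split; first by apply/pM; rewrite (cp j).2; congr lie; apply/pM.
    by rewrite hth (cp k).2 x'0 lie0r.
  have [|z Iz [_ z0]|I0|J0] := indecomposable_binary (indM j) Ij Jj.
  (* The choice of [x] makes [p k (q j x)] equal to [p k (th z)], so the remainder below lies in
     [J]. *)
  - move=> z Mz; have [x px xz] := surjpq (p k (th z)) (pp k _).
    exists (p j (thi x)), (z - p j (thi x)); split.
    + by exists x => //; apply/pM.
    + split; last by rewrite (linear_funB lth) (linear_funB lk) -xz /= px subrr.
      by apply/pM; rewrite (linear_funB lj) pp; congr (_ - _); apply/pM.
    + by rewrite addrC subrK.
  - move: Iz z0 => [x Mx ->] h.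
    rewrite [x](_ : x = 0) ?(linear_fun0 lthi) ?(linear_fun0 lj) //.
    by apply: injpq; rewrite /=; move/pM: Mx => // ->.
  (* If [I] were zero, [q j] would vanish on [M k], against injectivity. *)
  - case: (Mn0 k); apply/seteqP; split=> x; last first.
      by move=> /= ->; apply/pM; rewrite (linear_fun0 lk).
    move=> Mx; have : I (p j (thi x)) by exists x.
    rewrite I0 /= => x0; apply: injpq; first exact/pM.
    move/pM: Mx => Mx.
    by rewrite /= Mx /q /= x0 (linear_fun0 lth) (linear_fun0 lk).
  - move=> My; have [x px xy] := surjpq (p k (th y)) (pp k _).
    exists x; first exact/pM.
    have : J (y - p j (thi x)).
      split; last by rewrite (linear_funB lth) (linear_funB lk) -xy /= px subrr.
      by apply/pM; rewrite (linear_funB lj) pp; congr (_ - _); apply/pM.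
    by rewrite J0 /= => /eqP; rewrite subr_eq0 => /eqP.
pose b := exchange (p k) (q j).
have cb : centroid b by exact: exchange_centroid.
have zb x : lie_center L (b x - x) by exact: exchange_central.
have bb : bijective b by exact: exchange_bij.
have ab := central_centroid_automorphism cb bb zb.
have [b' bK b'K] := bb; have ab' := automorphism_fun_inverse ab bK b'K.
have bk x : M k x -> b x = th (p j (thi x)).
  by move=> /pM px; rewrite /b /exchange px subKr.
exists (b' \o th), j; split.
- exact: automorphism_fun_comp.
- by move=> x /=; rewrite -{1}[th x]b'K.
- apply/seteqP; split=> [_ [y /MjE[x Mx ->] <-] /=|x Mx].
    by rewrite -bk // bK.
  exists (p j (thi x)); first exact/pM.
  by rewrite /= -bk // bK.
move=> i i' ik thM; rewrite -image_comp thM.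
(* As [p k] vanishes on [M i], [b] and its inverse fix [M i] pointwise. *)
have bid x : M i x -> b' x = x.
  move=> /pM px; rewrite -{1}[x](_ : b x = x) ?bK // /b /exchange.
  rewrite -{2 3}px pp0 1?eq_sym // (linear_fun0 (cq j).1) subrr subr0 //.
apply/seteqP; split=> [_ [x Mx <-]|x Mx]; first by rewrite bid.
by exists x; rewrite ?bid.
Qed.

(** Induction on the number of summands already known to be images of summands; central differences
    add up along the way. *)
Lemma permuting_automorphism phi : lie_automorphism_fun phi ->
  exists th, [/\ lie_automorphism_fun th, forall x, lie_center L (phi x - th x)
    & forall j, exists i, th @` M j = M i].
Proof.
move=> aphi.
have main n : (n <= r)%N -> exists th, [/\ lie_automorphism_fun th,
    forall x, lie_center L (phi x - th x)
    & forall i : 'I_r, (i < n)%N -> exists j, th @` M j = M i].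
  elim: n => [_|n IH nr].
    by exists phi; split=> // x; rewrite subrr; apply: lie_center0.
  have [th [ath zth thM]] := IH (ltnW nr).
  have [th' [j [ath' zth' th'j th'M]]] :=
    exchange_automorphism (Ordinal nr) ath.
  exists th'; split=> // [x|i].
    by rewrite -(subrKA (th x)); apply: lie_centerD.
  rewrite ltnS leq_eqVlt; case: eqVneq => [ein _|ein /= lt_in].
    by exists j; rewrite th'j; congr M; apply: val_inj.
  by have [j' thj'] := thM i lt_in; exists j'; apply: th'M.
have [th [ath zth thM]] := main r (leqnn r).
exists th; split=> // j.
(* So far each target has a source; the goal asks for a target of each source. An injective [s] on a
   finite index set is bijective, which suffices. *)
have /choice[s sP] : forall i, exists j, th @` M j = M i.
  by move=> i; apply: thM.
have [p [cp pM _ pp0 _]] := decomposition_projections decM.1.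
have [_ _ Mn0 _ _] := decM.1.
(* Equal summands with distinct indices would be killed by their own projections, yet summands are
   nonzero. *)
have s_inj : injective s.
  move=> i i' ss; have MM : M i = M i' by rewrite -sP ss sP.
  apply/eqP/negPn/negP => ii'; apply: (Mn0 i).
  apply/seteqP; split=> x /= => [Mx|->]; last first.
    by apply/pM; rewrite (linear_fun0 (cp i).1).
  by have /pM <- := Mx; move: Mx; rewrite MM => /pM <-; rewrite pp0.
by have [s' _ s's] := injF_bij s_inj; exists (s' j); rewrite -(sP (s' j)) s's.
Qed.

End ExchangeStep.
End LieAlgebras.

(** * Automorphisms as permuting automorphisms plus central maps *)

Theorem theorem3p4 (K : fieldType) (L : lieAlgType K)
  (artL : lie_artinian L) (noethL : lie_noetherian L)
  (r : nat) (M : 'I_r -> set L)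
  (decM : irreducible_decomposition [set: L] M)
  (phi : {linear L -> L}) (phi_bij : bijective phi) :
  lie_automorphism phi <->
  exists theta zeta : {linear L -> L},
    [/\ forall x : L, phi x = theta x + zeta x,
        lie_automorphism theta,
        forall i : 'I_r, theta @` M i = M i \/
          exists j : 'I_r, lie_isomorphic (M i) (M j) /\ theta @` M i = M j,
        zeta @` [set: L] `<=` lie_center L
      & zeta @` lie_derived L = [set 0]].
Proof.
split=> [[_ hphi]|[theta [zeta [phiE [_ htheta] _ zc z0]]]]; last first.
  split=> // x y.
  have zlie : zeta (lie x y) = 0.
    suff : [set 0] (zeta (lie x y)) by [].
    by rewrite -z0; exists (lie x y) => // S [_ sS]; apply: sS; exists x, y.
  rewrite phiE zlie addr0 htheta; symmetry.
  by apply: lie_mod_center; rewrite phiE addrC addKr; apply: zc; eexists.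
have aphi : lie_automorphism_fun phi by split=> // a x y; rewrite linearP.
have [th [[lth bth hth] zth thM]] :=
  permuting_automorphism artL noethL decM aphi.
have [theta thE] := linear_bundle lth.
have [zeta zE] :
    exists zeta : {linear L -> L}, zeta =1 (fun x => phi x - theta x).
  apply: linear_bundle => a x y.
  by rewrite (linearP phi) (linearP theta) scalerBr opprD addrACA.
have Eth : (theta : L -> L) = th by apply/funext.
exists theta, zeta; split.
- by move=> x; rewrite zE addrC subrK.
- by rewrite /lie_automorphism Eth.
(* The second alternative always holds, [th] itself giving the isomorphism, even when [j] is [i]. *)
- move=> i; right; have [j thj] := thM i; rewrite Eth; exists j; split=> //.
  exists th; split=> // [a x y _ _|x y _ _]; [exact: lth|exact: bij_inj].
- by move=> _ [x _ <-]; rewrite zE thE.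
(* The kernel of [zeta] is a subspace; it contains all brackets because [phi] and [theta] agree
   modulo the centre. *)
have kz : lie_derived L `<=` [set x | zeta x = 0].
  move=> x; apply; split=> [|_ [y [z ->]]] /=.
    split=> [|a y z /= y0 z0] /=; first exact: linear0.
    by rewrite linearP y0 z0 scaler0 addr0.
  rewrite zE Eth hphi hth; apply/eqP; rewrite subr_eq0; apply/eqP.
  exact: lie_mod_center.
apply/seteqP; split=> [_ [x /kz /= x0 <-]//|_ ->].
exists 0; last exact: linear0.
by move=> S [[S0 _] _].
Qed.
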